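(* A class of graphs has bounded cliquewidth if and only if it is distance-$\infty$ flip-breakable.
   Context: Flips: for a graph $G$, partition $\mathcal{K}$ of $V(G)$ and symmetric $F\subseteq\mathcal{K}^2$, $G\oplus_{\mathcal{K}}F$ is the graph on $V(G)$ where distinct $u,v$ are adjacent iff exactly one of ''$uv\in E(G)$'' and ''$(\mathcal{K}(u),\mathcal{K}(v))\in F$'' holds; a $k$-flip uses $|\mathcal{K}|\le k$. A class $\mathcal{C}$ is distance-$\infty$ flip-breakable if there exist a function $N:\mathbb{N}\to\mathbb{N}$ and a constant $k$ such that for all $m\in\mathbb{N}$, $G\in\mathcal{C}$ and $W\subseteq V(G)$ with $|W|\ge N(m)$ there exist subsets $A,B\subseteq W$ with $|A|,|B|\ge m$ and a $k$-flip $H$ of $G$ such that no $a\in A$ and $b\in B$ lie in the same connected component of $H$. Cliquewidth is the standard graph parameter. *)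

(* Defs.v *)
From mathcomp Require Import all_boot.
From mathcomp Require Import boolp.
Set Implicit Arguments.
Unset Strict Implicit.
Unset Printing Implicit Defensive.

Record sgraph : Type := SGraph {
  vertex :> finType;
  adj : rel vertex;
  adj_sym : symmetric adj;
  adj_irr : irreflexive adj }.

Definition isomorphic (G H : sgraph) : Prop :=
  exists2 f : G -> H,
    bijective f & forall x y : G, adj (f x) (f y) = adj x y.

(** A class need not be closed under isomorphism; every notion below is
    isomorphism-invariant. *)
Definition graph_class : Type := sgraph -> Prop.

Record lgraph (k : nat) : Type := LGraph {
  lgraph_graph :> sgraph;
  label : lgraph_graph -> 'I_k }.
Arguments LGraph {k} lgraph_graph label.

(** [CWempty] adds nothing for nonempty graphs; it only gives the graph without
    vertices clique-width 0. Joins are only allowed between distinct labels. *)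
Inductive cwexpr (k : nat) : Type :=
| CWempty
| CWvertex of 'I_k
| CWunion of cwexpr k & cwexpr k
| CWjoin (i j : 'I_k) of i != j & cwexpr k
| CWrelabel of 'I_k & 'I_k & cwexpr k.
Arguments CWempty {k}.

Section Operations.
Variable k : nat.
Implicit Types G H : lgraph k.

Lemma edgeless_sym (T : finType) : symmetric (fun _ _ : T => false).
Proof. by []. Qed.

Lemma edgeless_irr (T : finType) : irreflexive (fun _ _ : T => false).
Proof. by []. Qed.

Definition edgeless (T : finType) : sgraph :=
  SGraph (@edgeless_sym T) (@edgeless_irr T).

Definition lempty : lgraph k :=
  LGraph (edgeless void) (fun x => match x with end).

Definition lvertex (i : 'I_k) : lgraph k := LGraph (edgeless unit) (fun=> i).

Definition union_adj G H (u v : G + H) : bool :=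
  match u, v with
  | inl x, inl y => adj x y
  | inr x, inr y => adj x y
  | _, _ => false
  end.

Lemma union_sym G H : symmetric (@union_adj G H).
Proof. by move=> [x|x] [y|y] //=; rewrite adj_sym. Qed.

Lemma union_irr G H : irreflexive (@union_adj G H).
Proof. by move=> [x|x] /=; rewrite adj_irr. Qed.

Definition lunion G H : lgraph k :=
  LGraph (SGraph (@union_sym G H) (@union_irr G H))
    (fun u => match u with inl x => label x | inr y => label y end).

Definition join_adj (i j : 'I_k) G (x y : G) : bool :=
  [|| adj x y, (label x == i) && (label y == j)
    | (label x == j) && (label y == i)].

Lemma join_sym i j G : symmetric (@join_adj i j G).
Proof.
move=> x y; rewrite /join_adj adj_sym; congr (_ || _).
by rewrite orbC; congr (_ || _); rewrite andbC.
Qed.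

Lemma join_irr i j G : i != j -> irreflexive (@join_adj i j G).
Proof.
move=> nij x; rewrite /join_adj adj_irr /= andbC orbb.
by apply/negP => /andP[/eqP -> /eqP eij]; rewrite eij eqxx in nij.
Qed.

Definition ljoin i j (nij : i != j) G : lgraph k :=
  LGraph (SGraph (@join_sym i j G) (@join_irr i j G nij)) (@label k G).

Definition lrelabel (i j : 'I_k) G : lgraph k :=
  LGraph G (fun x => if label x == i then j else label x).

Fixpoint cweval (e : cwexpr k) : lgraph k :=
  match e with
  | CWempty => lempty
  | CWvertex i => lvertex i
  | CWunion e1 e2 => lunion (cweval e1) (cweval e2)
  | CWjoin i j nij e1 => ljoin nij (cweval e1)
  | CWrelabel i j e1 => lrelabel i j (cweval e1)
  end.

End Operations.

Definition cw_expressible (G : sgraph) (k : nat) : Prop :=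
  exists e : cwexpr k, isomorphic (cweval e) G.

Lemma cw_expressible_card (G : sgraph) : cw_expressible G #|G|.
Proof.
have vertices (s : seq G) : uniq s -> exists (e : cwexpr #|G|) (f : cweval e -> G),
    [/\ injective f, forall x, (x \in s) <-> exists u, f u = x,
        forall u, label u = enum_rank (f u) & forall u v : cweval e, adj u v = false].
  elim: s => [_|x s IHs /= /andP[xs /IHs [e [f [injf imf labf adjf]]]]].
    exists CWempty, (fun u : void => match u with end).
    by split=> [[]|x|[]|[]] //; split=> [|[[]]].
  exists (CWunion (CWvertex (enum_rank x)) e),
    (fun u : unit + cweval e => if u is inr v then f v else x); split.
  - move=> [[]|u] [[]|v] //= fuv; last by rewrite (injf u v).
      by move/negP: xs; case; apply/imf; exists v.
    by move/negP: xs; case; apply/imf; exists u.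
  - move=> y; rewrite inE; split.
      case/predU1P=> [->|/imf[u <-]]; first by exists (inl tt).
      by exists (inr u).
    by case=> [[[]|u] <-]; [rewrite eqxx | apply/orP; right; apply/imf; exists u].
  - by case=> [[]|u] /=.
  - by move=> [[]|u] [[]|v] /=.
have edges (ps : seq (G * G)) : exists (e : cwexpr #|G|) (f : cweval e -> G),
    [/\ bijective f, forall u, label u = enum_rank (f u)
      & forall u v : cweval e, adj u v =
          (f u != f v) && (((f u, f v) \in ps) || ((f v, f u) \in ps))].
  elim: ps => [|[a b] ps [e [f [bijf labf adjf]]]].
    have [e [f [injf imf labf adjf]]] := vertices _ (enum_uniq G).
    exists e, f; split=> // [|u v]; last by rewrite adjf andbF.
    have surj (x : G) : exists u, f u == x.
      by have /imf[u fu] : x \in enum G by [rewrite mem_enum];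
         exists u; apply/eqP.
    exists (fun x => xchoose (surj x)) => [u|x]; last exact/eqP/(xchooseP (surj x)).
    exact/injf/eqP/(xchooseP (surj (f u))).
  have [eab|nab] := eqVneq a b.
    subst b; exists e, f; split=> // u v; rewrite adjf !inE !xpair_eqE.
    have [|nfuv] := eqVneq (f u) (f v) => //=.
    case: (eqVneq (f u) a) (eqVneq (f v) a) => [fua|_] [fva|_] //=.
    by rewrite fua fva eqxx in nfuv.
  have nij : enum_rank a != enum_rank b by rewrite (inj_eq enum_rank_inj).
  exists (CWjoin nij e), f; split=> // u v.
  rewrite /= /join_adj adjf !labf !(inj_eq enum_rank_inj) !inE !xpair_eqE.
  have [fuv|_] /= := eqVneq (f u) (f v).
    rewrite fuv; case: (eqVneq (f v) a) => [->|_] //=; last by rewrite andbF.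
    by rewrite (negbTE nab).
  rewrite [(f v == a) && _]andbC.
  by do 2!case: (_ && _); case: (_ \in ps); case: (_ \in ps).
have [e [f [bijf _ adjf]]] := edges [seq p <- enum {: G * G} | adj p.1 p.2].
have memE (x y : G) :
    ((x, y) \in [seq p <- enum {: G * G} | adj p.1 p.2]) = adj x y.
  by rewrite mem_filter mem_enum andbT.
exists e; exists f => // u v; rewrite adjf !memE [adj (f v) _]adj_sym orbb.
by have [->|] := eqVneq (f u) (f v); rewrite ?adj_irr.
Qed.

Lemma cw_expressible_ex (G : sgraph) : exists k, `[< cw_expressible G k >].
Proof. by exists #|G|; apply/asboolP/cw_expressible_card. Qed.

Definition cliquewidth (G : sgraph) : nat := ex_minn (cw_expressible_ex G).

Definition bounded_cliquewidth (C : graph_class) : Prop :=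
  exists k : nat, forall G : sgraph, C G -> cliquewidth G <= k.

Record kflip (k : nat) (G : sgraph) : Type := KFlip {
  flip_part : {set {set G}};
  flip_pairs : {set {set G} * {set G}};
  flip_partition : partition flip_part [set: G];
  flip_card : #|flip_part| <= k;
  flip_sub : flip_pairs \subset setX flip_part flip_part;
  flip_symmetric : forall X Y, ((X, Y) \in flip_pairs) = ((Y, X) \in flip_pairs) }.

Section FlippedGraph.
Variables (k : nat) (G : sgraph) (H : kflip k G).

Definition flip_adj (u v : G) : bool :=
  (u != v) &&
  (adj u v (+)
     ((pblock (flip_part H) u, pblock (flip_part H) v) \in flip_pairs H)).

Lemma flip_adj_sym : symmetric flip_adj.
Proof.
by move=> u v; rewrite /flip_adj eq_sym adj_sym flip_symmetric.
Qed.

Lemma flip_adj_irr : irreflexive flip_adj.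
Proof. by move=> u; rewrite /flip_adj eqxx. Qed.

Definition flip_graph : sgraph := SGraph flip_adj_sym flip_adj_irr.

End FlippedGraph.

Definition same_component (G : sgraph) (u v : G) : bool := connect (@adj G) u v.

Definition infty_flip_breakable (C : graph_class) : Prop :=
  exists (N : nat -> nat) (k : nat),
    forall (m : nat) (G : sgraph) (W : {set G}), C G -> N m <= #|W| ->
    exists (A B : {set G}) (H : kflip k G),
      [/\ A \subset W, B \subset W, m <= #|A|, m <= #|B|
        & forall a b : G, a \in A -> b \in B ->
            ~~ @same_component (flip_graph H) a b].

(* Main.v *)
(** Bounded clique-width gives flips: some subexpression contains a balanced part
    [X] of [W], and the edges leaving [X] depend only on at most [k] label classes
    inside and [2 ^ k] neighbourhood classes outside, so one flip removes them.

    Conversely, a flip that breaks [W] yields a balanced cut of [W] of cut-rank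
    at most [k]. Cut-rank is submodular, and a vertex set [X] of maximal allowed
    cut-rank [w] has a set [W] of [w] vertices outside it witnessing this rank.
    A cut breaking this [W] therefore splits [X] into two parts of smaller cut-rank.
    Iterating decomposes the graph along sets of cut-rank at most [w], which have
    at most [2 ^ w] neighbourhood classes, and this decomposition is turned into a
    clique-width expression. *)
Require Import Defs.
From mathcomp Require Import all_boot all_algebra.
From mathcomp Require Import boolp zify.
Set Implicit Arguments.
Unset Strict Implicit.
Unset Printing Implicit Defensive.
Import GRing.Theory.

(** * Bounded clique-width gives flips that separate a balanced part *)

Definition twins (G : sgraph) (X : {set G}) (x y : G) : Prop :=
  forall z, z \notin X -> adj x z = adj y z.

(** Descend into a side of a union as long as it keeps at least [m] vertices of [W], and take for
    [X] the vertices of the subexpression reached. The colouring [c] records the labels at that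
    point. Later operations see only labels, so equal colours keep equal labels; carrying this
    clause through the induction is what preserves twins under joins. *)
Lemma cwexpr_balanced_cut (k m : nat) (e : cwexpr k) (W : {set cweval e}) :
  0 < m -> m <= #|W| ->
  exists (X : {set cweval e}) (c : cweval e -> 'I_k),
    [/\ m <= #|W :&: X| <= 2 * m,
        {in X &, forall x y, c x = c y -> label x = label y}
      & {in X &, forall x y, c x = c y -> twins X x y}].
Proof.
move=> m_gt0; elim: e W => [|i|e1 IH1 e2 IH2|i j nij e IH|i j e IH] W leW.
- by have : m <= #|{: void}| := leq_trans leW (max_card _); rewrite card_void; lia.
- exists setT, (@label k _); split=> [|x y|x y _ _ _ z]; rewrite ?in_setT //.
  rewrite setIT leW (@leq_trans #|{: unit}|) ?max_card //.
  by rewrite card_unit; lia.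
- have inlI : injective (@inl (cweval e1) (cweval e2)) by move=> ? ? [].
  have inrI : injective (@inr (cweval e1) (cweval e2)) by move=> ? ? [].
  set W1 : {set cweval e1} := inl @^-1: W.
  set W2 : {set cweval e2} := inr @^-1: W.
  have [leW1|ltW1] := leqP m #|W1|.
    have [X [c [cX labX adjX]]] := IH1 _ leW1.
    exists (inl @: X : {set cweval e1 + cweval e2}),
      (fun u => match u with inl x => c x | inr y => label y end); split.
    + rewrite (_ : W :&: _ = inl @: (W1 :&: X)) ?card_imset //.
      apply/setP=> u; rewrite in_setI; apply/andP/imsetP.
        by case=> Wu /imsetP[x Xx def_u]; exists x; rewrite // !inE Xx -def_u Wu.
      by case=> x; rewrite !inE => /andP[Wx Xx] ->; rewrite Wx imset_f.
    + by move=> _ _ /imsetP[x Xx ->] /imsetP[y Xy ->] /=; apply: labX.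
    + move=> _ _ /imsetP[x Xx ->] /imsetP[y Xy ->] /= cxy [z|z] //=.
      by rewrite mem_imset // => /(adjX _ _ Xx Xy cxy).
  have [leW2|ltW2] := leqP m #|W2|.
    have [X [c [cX labX adjX]]] := IH2 _ leW2.
    exists (inr @: X : {set cweval e1 + cweval e2}),
      (fun u => match u with inl x => label x | inr y => c y end); split.
    + rewrite (_ : W :&: _ = inr @: (W2 :&: X)) ?card_imset //.
      apply/setP=> u; rewrite in_setI; apply/andP/imsetP.
        by case=> Wu /imsetP[x Xx def_u]; exists x; rewrite // !inE Xx -def_u Wu.
      by case=> x; rewrite !inE => /andP[Wx Xx] ->; rewrite Wx imset_f.
    + by move=> _ _ /imsetP[x Xx ->] /imsetP[y Xy ->] /=; apply: labX.
    + move=> _ _ /imsetP[x Xx ->] /imsetP[y Xy ->] /= cxy [z|z] //=.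
      by rewrite mem_imset // => /(adjX _ _ Xx Xy cxy).
  (* Both sides hold fewer than [m] vertices of [W], so all of [W] has fewer than [2 * m] and the
     descent stops here. *)
  exists setT, (@label k _); split=> [|x y|x y _ _ _ z]; rewrite ?in_setT //.
  rewrite setIT leW /=.
  have -> : #|W| = #|W1| + #|W2|.
    rewrite -(card_imset W1 inlI) -(card_imset W2 inrI) -cardsUI.
    rewrite [X in _ = _ + X](_ : _ = 0) ?addn0.
      apply: eq_card => -[x|y]; rewrite in_setU ?(mem_imset _ _ inlI) ?(mem_imset _ _ inrI) inE.
        by case: imsetP => [[]//|_]; rewrite orbF.
      by case: imsetP => [[]//|_].
    apply: eq_card0 => u; rewrite !inE.
    by apply/andP=> -[/imsetP[x _ ->] /imsetP[]].
  by lia.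
- have [X [c [cX labX adjX]]] := IH W leW; exists X, c; split=> // x y Xx Xy cxy z Xz.
  by rewrite /= /join_adj (adjX _ _ Xx Xy cxy z Xz) (labX _ _ Xx Xy cxy).
- have [X [c [cX labX adjX]]] := IH W leW; exists X, c; split=> // x y Xx Xy cxy /=.
  by rewrite (labX _ _ Xx Xy cxy).
Qed.

Lemma flip_of_cut (k : nat) (G : sgraph) (X : {set G}) (c : G -> 'I_k) :
  {in X &, forall x y, c x = c y -> twins X x y} ->
  exists H : kflip (k + 2 ^ k) G,
    {in X & ~: X, forall a b, ~~ @same_component (flip_graph H) a b}.
Proof.
move=> twX.
(* A vertex of [X] is classified by its colour, a vertex outside by the set of colours it sees in
   [X]. Since equal colours are twins, a class inside and a class outside are joined completely or
   not at all, and flipping the joined pairs removes every crossing edge. *)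
pose g (x : G) : 'I_k + {set 'I_k} :=
  if x \in X then inl (c x)
  else inr [set i | [exists y in X, (c y == i) && adj y x]].
have gX x y : g x = g y -> (x \in X) = (y \in X).
  by rewrite /g; case: (x \in X); case: (y \in X).
pose P := preim_partition g [set: G].
have partP : partition P [set: G] := preim_partitionP g [set: G].
have [/eqP coverP tiP _] := and3P partP.
have pbE x y : (x \in pblock P y) = (g y == g x).
  rewrite pblock_equivalence_partition ?inE //.
  by split=> // /eqP->.
pose E : rel G := fun x y => adj x y && ((x \in X) != (y \in X)).
pose F := [set AB | [&& AB.1 \in P, AB.2 \in P &
                     [exists x in AB.1, [exists y in AB.2, E x y]]]].
have EC x y : E x y = E y x by rewrite /E adj_sym eq_sym.
have cardP : #|P| <= k + 2 ^ k.
  have -> : k + 2 ^ k = #|{: 'I_k + {set 'I_k}}|.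
    by rewrite card_sum card_ord -cardsT -powersetT card_powerset cardsT card_ord.
  have -> : P = [set g @^-1: [set t] | t in codom g].
    apply/setP=> A; apply/imsetP/imsetP => [[x _ ->]|[_ /codomP[x ->] ->]].
      by exists (g x); rewrite ?codom_f //; apply/setP=> y; rewrite !inE eq_sym.
    by exists x => //; apply/setP=> y; rewrite !inE eq_sym.
  by apply: leq_trans (leq_imset_card _ _) (max_card _).
have subF : F \subset setX P P.
  by apply/subsetP=> -[A B]; rewrite !inE => /and3P[-> ->].
have symF A B : ((A, B) \in F) = ((B, A) \in F).
  have symF' A' B' : (A', B') \in F -> (B', A') \in F.
    rewrite !inE => /and3P[/= -> -> /exists_inP[x Ax /exists_inP[y By Exy]]] /=.
    by apply/exists_inP; exists y => //; apply/exists_inP; exists x; rewrite // EC.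
  by apply/idP/idP; apply: symF'.
pose H := KFlip partP cardP subF symF; exists H.
have flipX u v : u \in X -> v \notin X -> flip_adj H u v = false.
  move=> Xu Xv; rewrite /flip_adj /= -/P; apply/andP=> -[_].
  suff -> : ((pblock P u, pblock P v) \in F) = adj u v by rewrite addbb.
  rewrite inE /= !pblock_mem ?coverP ?inE //=; apply/exists_inP/idP => [[x ux]|uv].
    case/exists_inP=> y vy /andP[xy _].
    move: ux vy; rewrite !pbE => /eqP gux /eqP gvy.
    have Xx : x \in X by rewrite -(gX _ _ gux).
    have Xy : y \notin X by rewrite -(gX _ _ gvy).
    (* [y] sees the colour of [u] through [x], hence so does [v], through some [z]; as [z] and [u]
       are twins, [u] is adjacent to [v]. *)
    move: (gux) (gvy); rewrite /g Xu Xx (negbTE Xv) (negbTE Xy) => -[cux] [].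
    move/setP/(_ (c u)); rewrite !inE => cE.
    have : [exists z in X, (c z == c u) && adj z y].
      by apply/exists_inP; exists x; rewrite // cux eqxx xy.
    rewrite -cE => /exists_inP[z Xz /andP[/eqP czu zv]].
    by rewrite -(twX z u Xz Xu czu v Xv).
  exists u; first by rewrite pbE.
  by apply/exists_inP; exists v; rewrite ?pbE // /E uv Xu (negbTE Xv).
move=> a b Xa; rewrite inE; apply: contra => ab.
suff clX : closed (@adj (flip_graph H)) (mem X) by rewrite -(closed_connect clX ab).
apply: intro_closed => [x y|x y xy Xx]; first by apply: sym_connect_sym; apply: adj_sym.
by apply: contraTT xy => Xy; rewrite /= flipX.
Qed.

Lemma bounded_cliquewidth_flip_breakable (C : graph_class) :
  bounded_cliquewidth C -> infty_flip_breakable C.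
Proof.
(* The balanced part takes at most [2 * m.+1] of the [3 * m.+1] vertices and leaves at least [m.+1].
   The successor provides the positive threshold that the balanced cut requires. *)
case=> K bC; exists (fun m => 3 * m.+1), (K + 2 ^ K) => m G W /bC cwG leW.
have : cw_expressible G (cliquewidth G).
  by rewrite /cliquewidth; case: ex_minnP => k /asboolP.
case=> e [f [g fK gK] adjf].
have cardW : #|f @^-1: W| = #|W|.
  rewrite -(card_imset _ (can_inj fK)); apply: eq_card => x.
  by rewrite -(gK x) mem_imset ?inE //; apply: can_inj fK.
have lem : m.+1 <= #|f @^-1: W| by rewrite cardW; lia.
have [X [c [/andP[leX geX] _ twX]]] := cwexpr_balanced_cut (ltn0Sn m) lem.
have Xg x : (x \in g @^-1: X) = (g x \in X) by rewrite inE.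
have twgX : {in g @^-1: X &, forall x y,
    widen_ord cwG (c (g x)) = widen_ord cwG (c (g y)) -> twins (g @^-1: X) x y}.
  move=> x y; rewrite !Xg => Xx Xy /(congr1 val) /= /val_inj cxy z; rewrite Xg => Xz.
  by have := twX _ _ Xx Xy cxy _ Xz; rewrite -!adjf !gK.
have [H sepH] := flip_of_cut twgX.
have cardWX : #|W :&: g @^-1: X| = #|f @^-1: W :&: X|.
  rewrite -(card_imset _ (can_inj fK)); apply: eq_card => x.
  by rewrite -(gK x) mem_imset ?inE ?fK //; apply: can_inj fK.
exists (W :&: g @^-1: X), (W :\: g @^-1: X), H.
split; rewrite ?subsetIl ?subsetDl //.
- by rewrite cardWX; apply: ltnW.
- have := cardsID (g @^-1: X) W; rewrite cardWX; lia.
- by move=> a b /setIP[_ Xa] /setDP[_ Xb]; apply: sepH; rewrite // inE.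
Qed.

(** * Cut-rank over the two-element field, expressed by dimensions of subspaces *)

Section CutRank.
Variable G : sgraph.
Implicit Types (X Y Z D J W : {set G}) (x y z : G).

Local Notation vT := 'rV['F_2]_#|G|.

Definition unit_vec x : vT := delta_mx 0%R (enum_rank x).
Definition row_vec x : vT := (\sum_y (adj x y)%:R *: unit_vec y)%R.

Definition coord_space X : {vspace vT} := (\sum_(x in X) <[unit_vec x]>)%VS.
(** [\dim (cut_space X) - #|X|] is the rank over [F_2] of the adjacency matrix
    between [X] and its complement; written this way, submodularity is the
    dimension formula for sums and intersections of subspaces. *)
Definition cut_space X : {vspace vT} :=
  (\sum_(x in X) (<[row_vec x]> + <[unit_vec x]>))%VS.

Lemma mem_coord_space X x : x \in X -> unit_vec x \in coord_space X.
Proof. by move=> Xx; rewrite memvE (sumv_sup x). Qed.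

Lemma fullv_sub (U : {vspace vT}) : (fullv <= U)%VS -> U = fullv.
Proof. by move=> fU; apply/eqP; rewrite eqEsubv subvf. Qed.

Lemma dim_fullv : \dim (fullv : {vspace vT}) = #|G|.
Proof. by rewrite dimvf; apply: mul1n. Qed.

Lemma dim_leq_card (U : {vspace vT}) : \dim U <= #|G|.
Proof. by have := dimvS (subvf U); rewrite [leqRHS]dim_fullv. Qed.

Lemma coord_spaceT : coord_space setT = fullv.
Proof.
apply: fullv_sub; apply/subvP=> v _.
rewrite (row_sum_delta v).
rewrite (reindex_onto (@enum_rank G) enum_val) /= => [|i _]; last exact: enum_valK.
by apply: memv_suml => x _; rewrite memvZ ?mem_coord_space.
Qed.

Lemma dim_coord_space X : \dim (coord_space X) <= #|X|.
Proof.
apply: leq_trans (dimv_leq_sum _ _ _) _; rewrite -sum1_card.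
by apply: leq_sum => x _; rewrite dim_vline leq_b1.
Qed.

Lemma row_unit_cut_space X x : x \in X ->
  (row_vec x \in cut_space X) && (unit_vec x \in cut_space X).
Proof.
move=> Xx; rewrite !memvE.
by rewrite !(sumv_sup x) // ?addvSl ?addvSr.
Qed.

Lemma cut_space_subP X (U : {vspace vT}) :
  {in X, forall x, (row_vec x \in U) && (unit_vec x \in U)} ->
  (cut_space X <= U)%VS.
Proof. by move=> UX; apply/subv_sumP=> x /UX; rewrite subv_add -!memvE. Qed.

Lemma cut_spaceS X Y : X \subset Y -> (cut_space X <= cut_space Y)%VS.
Proof. by move/subsetP=> XY; apply: cut_space_subP => x /XY/row_unit_cut_space. Qed.

Lemma dim_cut_space_submod X Z :
  \dim (cut_space (X :&: Z)) + \dim (cut_space (X :|: Z))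
    <= \dim (cut_space X) + \dim (cut_space Z).
Proof.
rewrite -[leqRHS]dimv_sum_cap addnC leq_add ?dimvS //.
  apply: cut_space_subP => x; case/setUP=> /row_unit_cut_space/andP[rx ux].
    by rewrite !(subvP (addvSl _ _)).
  by rewrite !(subvP (addvSr _ _)).
by rewrite subv_cap !cut_spaceS ?subsetIl ?subsetIr.
Qed.

(** Each coordinate vector of [D] outside the current space raises its dimension by one, so the
    induction is on the codimension of [U]. *)
Lemma steinitz (U : {vspace vT}) D : (U + coord_space D)%VS = fullv ->
  exists J : {set G}, [/\ J \subset D, \dim U + #|J| <= #|G|
              & (U + coord_space J)%VS = fullv].
Proof.
have [n] := ubnP (#|G| - \dim U); elim: n U => // n IH U leUn UD.
have [Uf|Uf] := eqVneq U fullv.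
  by exists set0; rewrite sub0set cards0 addn0 dim_leq_card; split=> //;
    apply: fullv_sub; rewrite Uf addvSl.
have [x Dx Ux] : exists2 x, x \in D & unit_vec x \notin U.
  apply/exists_inP; apply: contraNT Uf; rewrite negb_exists_in => /forall_inP sDU.
  rewrite -UD eqEsubv addvSl subv_add subvv; apply/subv_sumP=> x /sDU.
  by rewrite negbK memvE.
have dimU : \dim (U + <[unit_vec x]>) = (\dim U).+1.
  rewrite dimv_disjoint_sum; last first.
    apply/eqP; rewrite -subv0; apply/subvP=> v /memv_capP[Uv /vlineP[a def_v]].
    rewrite memv0 def_v; have [->|a0] := eqVneq a 0%R; first by rewrite scale0r.
    by case/negP: Ux; rewrite -(scalerK a0 (unit_vec x)) -def_v memvZ.
  rewrite dim_vline; case: eqP Ux => [->|_ _]; first by rewrite mem0v.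
  exact: addn1.
have ltU : \dim U < #|G|.
  by rewrite -dimU dim_leq_card.
have [||J [JD leJ fJ]] := IH (U + <[unit_vec x]>)%VS.
- by rewrite dimU; lia.
- by apply: fullv_sub; rewrite -UD addvS ?addvSl.
exists (x |: J); split.
- by rewrite subUset sub1set Dx.
- apply: leq_trans leJ; rewrite [X in _ <= X + _]dimU cardsU1 addSnnS leq_add2l.
  by case: (_ \notin _).
apply: fullv_sub; rewrite -fJ -addvA addvS // subv_add -memvE.
rewrite mem_coord_space ?setU11 //; apply/subv_sumP=> y Jy.
by rewrite -memvE mem_coord_space // setU1r.
Qed.

(** The coordinates in [J] complement [cut_space X]. Hence the vertices outside both [X] and [J]
    index a column basis of the adjacency matrix between [X] and its complement, and their number is
    the cut-rank of [X]. *)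
Lemma cut_basis X : exists J,
  [/\ J \subset ~: X, \dim (cut_space X) + #|J| = #|G|,
      (cut_space X + coord_space J)%VS = fullv
    & (cut_space X :&: coord_space J)%VS = 0%VS].
Proof.
have [|J [JX leJ fJ]] := @steinitz (cut_space X) (~: X).
  apply: fullv_sub; rewrite -coord_spaceT; apply/subv_sumP=> x _.
  rewrite -memvE; have [Xx|Xx] := boolP (x \in X).
    by apply/(subvP (addvSl _ _)); case/andP: (row_unit_cut_space Xx).
  by apply/(subvP (addvSr _ _)); rewrite mem_coord_space // inE.
have := dimv_sum_cap (cut_space X) (coord_space J); rewrite fJ dim_fullv.
have := dim_coord_space J => leJJ dimE.
exists J; split=> //; first lia.
by apply/eqP; rewrite -dimv_eq0; lia.
Qed.

(** The set [W] is the column basis. Since [cut_space (X :|: Z)] contains [cut_space X] and the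
    coordinates in [Z], adding the coordinates in [J :\: Z] fills the space; the other vertices
    outside [X :|: Z], namely [W :\: Z], are thus bounded in number by the cut-rank of [X :|: Z]. *)
Lemma cut_space_probe X w : \dim (cut_space X) = #|X| + w ->
  exists2 W : {set G}, #|W| = w &
    forall Z, #|X :|: Z| + #|W :\: Z| <= \dim (cut_space (X :|: Z)).
Proof.
move=> dimX; have [J [JX cJ fJ _]] := cut_basis X.
have := cardsC (X :|: J); have := cardsUI X J.
rewrite [X :&: J](_ : _ = set0) ?cards0; last first.
  by apply/setP=> x; rewrite !inE; apply/andP=> -[Xx /(subsetP JX)]; rewrite inE Xx.
move=> cU cC; exists (~: (X :|: J)) => [|Z]; first by lia.
have : #|G| <= \dim (cut_space (X :|: Z)) + #|J :\: Z|.
  apply: leq_trans (leq_add (leqnn _) (dim_coord_space _)).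
  apply: leq_trans (dimv_add_leqif _ _).1; rewrite -[leqLHS]dim_fullv -fJ dimvS //.
  rewrite subv_add (subv_trans (cut_spaceS (subsetUl X Z))) ?addvSl //=.
  apply/subv_sumP=> x Jx; rewrite -memvE; have [Zx|Zx] := boolP (x \in Z).
    apply/(subvP (addvSl _ _)).
    by have /row_unit_cut_space/andP[] : x \in X :|: Z by rewrite inE Zx orbT.
  by apply/(subvP (addvSr _ _)); rewrite mem_coord_space // inE Zx.
have := cardsC (X :|: Z).
have -> : ~: (X :|: Z) = (J :\: Z) :|: (~: (X :|: J) :\: Z).
  apply/setP=> x; rewrite !inE; have := subsetP JX x; rewrite inE.
  by case: (x \in J) => [/(_ isT)|_]; case: (x \in Z); case: (x \in X).
have := cardsUI (J :\: Z) (~: (X :|: J) :\: Z).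
have -> : (J :\: Z) :&: (~: (X :|: J) :\: Z) = set0.
  by apply/setP=> x; rewrite !inE; case: (x \in J); rewrite !(orbT, andbF).
rewrite cards0; lia.
Qed.

(** Outside [X], the neighbourhood of a vertex of [X] is determined by its trace on a column basis
    [W] of at most [w] vertices; the colour is the index of that trace. *)
Lemma twins_classes X w : \dim (cut_space X) <= #|X| + w ->
  exists c : G -> 'I_(2 ^ w),
    {in X &, forall x y, c x = c y <-> twins X x y}.
Proof.
move=> dimX; have [J [JX cJ fJ capJ]] := cut_basis X.
pose W := ~: (X :|: J).
have cW : #|W| <= w.
  have := cardsC (X :|: J); have := cardsUI X J.
  rewrite [X :&: J](_ : _ = set0) ?cards0 -/W; first lia.
  by apply/setP=> x; rewrite !inE; apply/andP=> -[Xx /(subsetP JX)]; rewrite inE Xx.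
pose nb x := [set y in W | adj x y].
have nbP x : nb x \in powerset W.
  by rewrite inE; apply/subsetP=> y; rewrite inE => /andP[].
have leP : #|powerset W| <= 2 ^ w by rewrite card_powerset leq_exp2l.
exists (fun x => widen_ord leP (enum_rank_in (nbP x) (nb x))) => x y Xx Xy.
split=> [/(congr1 val)/= /val_inj eqc|tw]; last first.
  congr widen_ord; apply: (@enum_val_inj _ (mem (powerset W))).
  rewrite !enum_rankK_in //; apply/setP=> z; rewrite !inE negb_or.
  by have [//|Xz] := boolP (z \in X); rewrite (tw z Xz).
have {eqc} eqW : nb x = nb y.
  by move/(congr1 enum_val): eqc; rewrite !enum_rankK_in.
pose a z : 'F_2 := ((adj x z)%:R - (adj y z)%:R)%R.
have aW z : z \in W -> a z = 0%R.
  move=> Wz; have /setP/(_ z) := eqW; rewrite [_ \in nb x]in_set [_ \in nb y]in_set Wz /= /a => ->.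
  by rewrite subrr.
(* If [x] and [y] agree on [W], the difference of their rows is supported on [X] and [J]. Its part
   [u] on [J] then lies in both [cut_space X] and [coord_space J], hence vanishes. *)
pose u : vT := (\sum_(z in J) a z *: unit_vec z)%R.
have uJ : u \in coord_space J.
  by apply: memv_suml => z Jz; rewrite memvZ ?mem_coord_space.
have uE : (u = row_vec x - row_vec y - \sum_(z in X) a z *: unit_vec z)%R.
  rewrite /row_vec -sumrB (eq_bigr (fun z => a z *: unit_vec z)%R) => [|z _]; last first.
    by rewrite -scalerBl.
  rewrite (bigID (mem X)) /= addrAC subrr add0r (bigID (mem J)) /= addrC.
  rewrite big1 => [|z /andP[Xz Jz]]; last first.
    by rewrite aW ?scale0r // !inE negb_or Xz.
  rewrite add0r; apply: eq_bigl => z; have := subsetP JX z; rewrite inE.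
  by case: (z \in J) => [/(_ isT) -> //|_]; rewrite andbF.
have u0 : u = 0%R.
  apply/eqP; rewrite -memv0 -capJ memv_cap uJ andbT uE.
  have rX z (Xz : z \in X) := andP (row_unit_cut_space Xz).
  rewrite !rpredB ?(rX x Xx).1 ?(rX y Xy).1 //.
  by apply: memv_suml => z Xz; rewrite memvZ ?(rX z Xz).2.
move=> z Xz; have [Jz|Jz] := boolP (z \in J); last first.
  have Wz : z \in W by rewrite !inE negb_or Xz.
  by have /setP/(_ z) := eqW; rewrite !inE negb_or Xz Jz.
have : a z = 0%R.
  have /matrixP/(_ 0%R (enum_rank z)) := u0.
  rewrite summxE (bigD1 z) //= !mxE !eqxx mulr1 big1 ?addr0 // => t /andP[_ tz].
  by rewrite !mxE (inj_eq enum_rank_inj) eq_sym (negbTE tz) mulr0.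
by rewrite /a; case: (adj x z); case: (adj y z).
Qed.

(** Modulo the coordinates in [Z], the row of a vertex of [Z] is one of the vectors [b t] with [t]
    in [P]. This bounds cut-rank by a number of classes. *)
Lemma dim_cut_space_classes (T : finType) (P : {set T}) (p : G -> T)
    (R : T -> G -> bool) Z :
  (forall x, p x \in P) ->
  (forall x y, x \in Z -> y \notin Z -> adj x y = R (p x) y) ->
  \dim (cut_space Z) <= #|Z| + #|P|.
Proof.
move=> Pp adjR.
pose b t : vT := (\sum_(y in ~: Z) (R t y)%:R *: unit_vec y)%R.
have dimb : \dim (\sum_(t in P) <[b t]>)%VS <= #|P|.
  apply: leq_trans (dimv_leq_sum _ _ _) _; rewrite -sum1_card.
  by apply: leq_sum => t _; rewrite dim_vline leq_b1.
apply: leq_trans (leq_add (dim_coord_space Z) dimb).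
apply: leq_trans (dimv_add_leqif _ _).1; apply/dimvS/cut_space_subP => x Zx.
apply/andP; split; last exact/(subvP (addvSl _ _))/mem_coord_space.
rewrite /row_vec (bigID (mem Z)) /= memv_add //.
  by apply: memv_suml => y Zy; rewrite memvZ ?mem_coord_space.
have -> : (\sum_(y | y \notin Z) (adj x y)%:R *: unit_vec y = b (p x))%R.
  by apply: eq_big => y => [|Zy]; rewrite ?inE ?adjR.
by rewrite memvE (sumv_sup (p x)).
Qed.

End CutRank.

(** * Building clique-width expressions on vertex subsets of a fixed graph *)

Section Realization.
Variables (G : sgraph) (T : finType).
Implicit Types (X Y : {set G}) (lab : G -> T) (r : rel G).

(** The relation [r] is kept apart from the adjacency of [G] so that intermediate stages, with some
    edges still missing, can be described. *)
Definition realizes X lab r : Prop :=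
  exists (e : cwexpr #|T|) (f : cweval e -> G),
    [/\ injective f, forall x, (x \in X) <-> exists u, f u = x,
        forall u, label u = enum_rank (lab (f u))
      & forall u v : cweval e, adj u v = r (f u) (f v)].

Lemma eq_realizes X lab1 lab2 r1 r2 :
    {in X, lab1 =1 lab2} -> {in X &, r1 =2 r2} ->
  realizes X lab1 r1 -> realizes X lab2 r2.
Proof.
move=> eqlab eqr [e [f [injf imf labf adjf]]]; exists e, f.
have Xf u : f u \in X by apply/imf; exists u.
by split=> // [u|u v]; [rewrite labf eqlab | rewrite adjf eqr].
Qed.

Lemma realizes0 lab r : realizes set0 lab r.
Proof.
exists CWempty, (fun u : void => match u with end).
by split=> [[]|x|[]|[]] //; rewrite inE; split=> // -[[]].
Qed.

Lemma realizes1 x lab r : ~~ r x x -> realizes [set x] lab r.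
Proof.
move=> rxx; exists (CWvertex (enum_rank (lab x))), (fun=> x).
split=> [[] []|y|u|u v] //=; last by rewrite (negbTE rxx).
by rewrite inE; split=> [/eqP ->|[_ ->]] //; exists tt.
Qed.

Lemma realizesU X Y lab r : [disjoint X & Y] ->
  realizes X lab r -> realizes Y lab r ->
  realizes (X :|: Y) lab (fun x y => r x y && ((x \in X) == (y \in X))).
Proof.
move=> disXY [e1 [f1 [injf1 imf1 labf1 adjf1]]] [e2 [f2 [injf2 imf2 labf2 adjf2]]].
have Xf u : f1 u \in X by apply/imf1; exists u.
have Xf2 u : (f2 u \in X) = false.
  by apply: (disjointFl disXY); apply/imf2; exists u.
exists (CWunion e1 e2),
  (fun u : cweval e1 + cweval e2 => match u with inl x => f1 x | inr y => f2 y end).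
split.
- move=> [u|u] [v|v] fuv; try by rewrite (injf1 u v) || rewrite (injf2 u v).
    by have := Xf u; rewrite fuv Xf2.
  by have := Xf v; rewrite -fuv Xf2.
- move=> x; rewrite inE; split=> [/orP[/imf1|/imf2] [u <-]|].
  + by exists (inl u).
  + by exists (inr u).
  + case=> -[u|u] <-; first by rewrite Xf.
    by apply/orP; right; apply/imf2; exists u.
- by case.
- by move=> [u|u] [v|v] /=; rewrite ?Xf ?Xf2 ?eqxx ?andbT ?andbF.
Qed.

Lemma realizes_join X lab r i j : i != j -> realizes X lab r ->
  realizes X lab (fun x y => [|| r x y, (lab x == i) && (lab y == j)
                                      | (lab x == j) && (lab y == i)]).
Proof.
rewrite -(inj_eq enum_rank_inj) => nij [e [f [injf imf labf adjf]]].
exists (CWjoin nij e), f; split=> // u v.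
by rewrite /= /join_adj adjf !labf !(inj_eq enum_rank_inj).
Qed.

Lemma realizes_joins X lab r (s : seq (T * T)) : {in s, forall p, p.1 != p.2} ->
  realizes X lab r ->
  realizes X lab (fun x y => [|| r x y, (lab x, lab y) \in s
                                      | (lab y, lab x) \in s]).
Proof.
move=> + Xr; elim: s => [|[i j] s IH] sP.
  by apply: eq_realizes Xr => // x y _ _; rewrite orbF.
have /IH IHs : {in s, forall p, p.1 != p.2}.
  by move=> p sp; apply: sP; rewrite inE sp orbT.
have nij : i != j by apply: (sP (i, j)); rewrite inE eqxx.
apply: eq_realizes (realizes_join nij IHs) => // x y _ _.
rewrite !inE !xpair_eqE [(lab y == i) && _]andbC.
by case: (r x y); do 2!case: (_ && _); do 2!case: (_ \in s).
Qed.

Lemma realizes_relabel1 X lab r i j : realizes X lab r ->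
  realizes X (fun x => if lab x == i then j else lab x) r.
Proof.
case=> e [f [injf imf labf adjf]].
exists (CWrelabel (enum_rank i) (enum_rank j) e), f; split=> // u.
by rewrite /= labf (inj_eq enum_rank_inj); case: ifP.
Qed.

(* Relabelling proceeds one label at a time, so the new labels must avoid the
   old ones. *)
Lemma realizes_relabel X lab lab' r :
    {in X &, forall x y, lab' x != lab y} ->
    {in X &, forall x y, lab x = lab y -> lab' x = lab' y} ->
  realizes X lab r -> realizes X lab' r.
Proof.
move=> freshX compX Xr.
suff relS (s : seq T) : realizes X (fun x => if lab x \in s then lab' x else lab x) r.
  by apply: eq_realizes (relS (enum T)) => // x _; rewrite mem_enum.
elim: s => [|i s IHs]; first by apply: eq_realizes Xr.
(* A representative [x0] supplies the new label for all of old label [i]. Vertices already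
   relabelled are left alone, because their new labels differ from [i]. *)
have [/exists_inP[x0 Xx0 /eqP def_i]|noi] := boolP [exists x in X, lab x == i].
  apply: eq_realizes (realizes_relabel1 i (lab' x0) IHs) => // x Xx /=.
  rewrite inE; have [sx|sx] := boolP (lab x \in s).
    by rewrite orbT -def_i (negbTE (freshX x x0 Xx Xx0)).
  rewrite orbF; case: eqP => // eqi; apply/esym/compX => //; by rewrite eqi.
apply: eq_realizes IHs => // x Xx; rewrite inE.
case: eqP => //= eqi; case/negP: noi; apply/exists_inP; exists x => //; exact/eqP.
Qed.

Lemma realizes_expressible lab : realizes setT lab (@adj G) ->
  cw_expressible G #|T|.
Proof.
case=> e [f [injf imf _ adjf]]; exists e, f => //.
have surj x : exists u, f u == x.
  by have /imf[u <-] := in_setT x; exists u.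
by exists (fun x => xchoose (surj x)) => [u|x]; [apply/injf|]; apply/eqP/(xchooseP (surj _)).
Qed.

End Realization.

(* The three tags keep the labels of [X], those of [Y] and the freshly assigned
   ones apart, as [realizes_relabel] requires. *)
Lemma realizes_glue (G : sgraph) (K : nat) (X Y : {set G}) (cX cY c : G -> 'I_K)
    (T := ('I_3 * 'I_K)%type : finType) :
  [disjoint X & Y] ->
  {in X &, forall x y, cX x = cX y -> twins X x y} ->
  {in Y &, forall x y, cY x = cY y -> twins Y x y} ->
  {in X :|: Y &, forall x y, twins (X :|: Y) x y -> c x = c y} ->
  realizes X (fun x => (0%R, cX x) : T) (@adj G) ->
  realizes Y (fun x => (0%R, cY x) : T) (@adj G) ->
  realizes (X :|: Y) (fun x => (0%R, c x) : T) (@adj G).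
Proof.
move=> disXY twX twY cP rX rY.
have YX x : x \in Y -> (x \in X) = false by apply: disjointFl.
have XY x : x \in X -> (x \in Y) = false by apply: disjointFr.
pose lab x : T := if x \in X then (0%R, cX x) else (1%R, cY x).
have {}rX : realizes X lab (@adj G).
  by apply: eq_realizes rX => // x Xx; rewrite /lab Xx.
have {}rY : realizes Y lab (@adj G).
  apply: realizes_relabel rY => [x y Yx Yy|x y Yx Yy [cxy]].
    by rewrite /lab YX // xpair_eqE.
  by rewrite /lab !YX // cxy.
have twU x y : x \in X :|: Y -> y \in X :|: Y -> lab x = lab y ->
    (x \in X) = (y \in X) /\ twins (if x \in X then X else Y) x y.
  rewrite !inE /lab; case: (boolP (x \in X)) => Xx; case: (boolP (y \in X)) => Xy //=.
    by move=> _ _ [cxy]; split=> //; apply: twX.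
  by move=> Yx Yy [cxy]; split=> //; apply: twY.
(* Join the label pairs that carry at least one edge between [X] and [Y]. Vertices with equal labels
   are twins, so these joins create only edges of [G]. *)
pose s := [seq p : T * T <- enum {: T * T} |
  [exists x in X, [exists y in Y, [&& adj x y, lab x == p.1 & lab y == p.2]]]].
have sP : {in s, forall p, p.1 != p.2}.
  move=> p; rewrite mem_filter.
  case/andP=> /exists_inP[x Xx /exists_inP[y Yy /and3P[_ /eqP <- /eqP <-]]] _.
  by rewrite /lab Xx YX // xpair_eqE.
have sE x y : x \in X :|: Y -> y \in X :|: Y ->
    ((lab x, lab y) \in s) = [&& x \in X, y \in Y & adj x y].
  move=> Ux Uy; rewrite mem_filter mem_enum andbT; apply/exists_inP/and3P.
    case=> x' Xx' /exists_inP[y' Yy' /and3P[xy' /eqP eqx /eqP eqy]].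
    have [|Xx tx] := twU _ _ _ Ux eqx; first by rewrite inE Xx'.
    have [|Xy ty] := twU _ _ _ Uy eqy; first by rewrite inE Yy' orbT.
    rewrite Xx' in Xx tx; rewrite YX // in Xy ty.
    have Yy : y \in Y by move: Uy; rewrite inE -Xy.
    split=> //; have Xy' : y' \notin X by rewrite YX.
    by rewrite adj_sym -ty -?Xx ?XY // adj_sym -tx.
  case=> Xx Yy xy; exists x => //; apply/exists_inP; exists y => //.
  by rewrite xy !eqxx.
have rU : realizes (X :|: Y) lab (@adj G).
  apply: eq_realizes (realizes_joins sP (realizesU disXY rX rY)) => // x y Ux Uy /=.
  rewrite !sE //; move: Ux Uy; rewrite !inE [adj y x]adj_sym.
  have [Xx|Xx] := boolP (x \in X); have [Xy|Xy] := boolP (y \in X) => /= Yx Yy.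
  - by rewrite !XY // andbT !orbF.
  - by rewrite Yy andbF /= orbF.
  - by rewrite Yx andbF.
  - by rewrite andbT orbF.
apply: (@realizes_relabel G T _ (fun x => (ord_max, c x) : T)) => [x y Ux Uy|x y Ux Uy [->]|] //.
apply: realizes_relabel rU => [x y Ux Uy|x y Ux Uy labxy].
  by rewrite /lab; case: ifP => _; rewrite xpair_eqE.
congr (_, _); apply: cP => // z; rewrite inE negb_or => /andP[Xz Yz].
by have [_] := twU _ _ Ux Uy labxy; case: ifP => _; apply.
Qed.

(** * Recursive decomposition along sets of cut-rank at most [w] *)

Lemma expressible_of_cuts (G : sgraph) (k w : nat) : 0 < w ->
  (forall W : {set G}, w <= #|W| -> exists Z : {set G},
     [/\ k < #|W :&: Z|, k < #|W :\: Z|, \dim (cut_space Z) <= #|Z| + k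
       & \dim (cut_space (~: Z)) <= #|~: Z| + k]) ->
  cw_expressible G #|{: 'I_3 * 'I_(2 ^ w)}|.
Proof.
move=> w_gt0 cutW.
pose T : finType := ('I_3 * 'I_(2 ^ w))%type.
(* The labels are exactly the twin classes: when gluing, each part must separate non-twins, while
   the union must identify its twins. *)
have main n (X : {set G}) (c : G -> 'I_(2 ^ w)) : #|X| <= n ->
    \dim (cut_space X) <= #|X| + w ->
    {in X &, forall x y, c x = c y <-> twins X x y} ->
    realizes X (fun x => (0%R, c x) : T) (@adj G).
  elim: n X c => [|n IH] X c leXn dimX cP.
    by have -> : X = set0; [apply/eqP; rewrite -cards_eq0; lia | apply: realizes0].
  have splitX Z : #|X :&: Z| < #|X| -> #|X :\: Z| < #|X| ->
      \dim (cut_space (X :&: Z)) <= #|X :&: Z| + w ->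
      \dim (cut_space (X :\: Z)) <= #|X :\: Z| + w ->
      realizes X (fun x => (0%R, c x) : T) (@adj G).
    move=> lt1 lt2 dim1 dim2; have [c1 c1P] := twins_classes dim1.
    have [c2 c2P] := twins_classes dim2.
    rewrite -[X](setID X Z); apply: (@realizes_glue _ _ _ _ c1 c2).
    - by rewrite -setI_eq0; apply/eqP/setP=> x; rewrite !inE; case: (x \in Z); rewrite ?andbF.
    - by move=> x y Xx Xy /c1P; apply.
    - by move=> x y Xx Xy /c2P; apply.
    - by rewrite setID => x y Xx Xy; apply: (cP x y Xx Xy).2.
    - by apply: IH => //; lia.
    - by apply: IH => //; lia.
  have [X1|X1] := leqP #|X| 1.
    have [->|[x Xx]] := set_0Vmem X; first exact: realizes0.
    have -> : X = [set x].
      by apply/esym/eqP; rewrite eqEcard sub1set Xx cards1.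
    by apply: realizes1; rewrite adj_irr.
  (* Below the maximal cut-rank, a single vertex can be split off: it has cut-rank at most one, and
     removing it from [X] raises the cut-rank by at most one. *)
  have [ltX|geX] := ltnP (\dim (cut_space X)) (#|X| + w).
    have [x Xx] : exists x, x \in X by apply/card_gt0P; lia.
    have := cardsD1 x X; rewrite Xx => cardX.
    have IX : X :&: [set x] = [set x] by apply/setIidPr; rewrite sub1set.
    apply: (splitX [set x]); rewrite ?IX ?cards1 //; first lia.
    - apply: leq_trans (dimv_leq_sum _ _ _) _; rewrite big_set1.
      apply: leq_trans (dimv_add_leqif _ _).1 _; rewrite !dim_vline.
      by do 2!case: (_ != _) => /=; lia.
    - have := dimvS (cut_spaceS (subsetDl X [set x])); lia.
  have dimXE : \dim (cut_space X) = #|X| + w by lia.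
  have [W cW probeW] := cut_space_probe dimXE.
  have [|Z [W1 W2 dimZ dimCZ]] := cutW W; first by rewrite cW.
  (* By submodularity both parts have smaller cut-rank than [X], hence neither
     is all of [X]. *)
  have part Z' : k < #|W :\: Z'| -> \dim (cut_space Z') <= #|Z'| + k ->
      \dim (cut_space (X :&: Z')) < #|X :&: Z'| + w.
    (* In terms of cut-rank, the intersection has at most [w + k - #|W :\: Z'|], which is less than
       [w]. *)
    move=> WZ dimZ'; have := dim_cut_space_submod X Z'; have := probeW Z'.
    have := cardsUI X Z'; lia.
  have dim1 := part Z W2 dimZ.
  have dim2 : \dim (cut_space (X :\: Z)) < #|X :\: Z| + w.
    by rewrite setDE; apply: part; rewrite // setDE setCK.
  have proper (Y : {set G}) : Y \subset X -> \dim (cut_space Y) < #|Y| + w -> #|Y| < #|X|.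
    move=> YX dimY; rewrite proper_card // properEneq YX andbT.
    by apply: contraTneq dimY => ->; rewrite dimXE ltnn.
  apply: (splitX Z); [exact: proper (subsetIl X Z) dim1 |
    exact: proper (subsetDl X Z) dim2 | exact: ltnW | exact: ltnW].
have dimT : \dim (cut_space [set: G]) <= #|[set: G]| + w.
  by rewrite cardsT (leq_trans (dim_leq_card _)) ?leq_addr.
have [c cP] := twins_classes dimT.
exact: realizes_expressible (main _ _ _ (leqnn _) dimT cP).
Qed.

(** * Flips yield balanced cuts of small cut-rank *)

Lemma flip_breakable_bounded_cliquewidth (C : graph_class) :
  infty_flip_breakable C -> bounded_cliquewidth C.
Proof.
(* Sets of size [k.+1] on both sides exceed the cut-rank bound [k]; the outer successor makes [w]
   positive. *)
case=> N [k brC]; set w := (N k.+1).+1.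
exists #|{: 'I_3 * 'I_(2 ^ w)}| => G CG.
suff exprG : cw_expressible G #|{: 'I_3 * 'I_(2 ^ w)}|.
  by rewrite /cliquewidth; case: ex_minnP => n _; apply; apply/asboolP.
apply: (@expressible_of_cuts _ k) => // W leW.
have [A [B [H [/subsetP AW /subsetP BW cA cB sepAB]]]] := brC _ _ _ CG (ltnW leW).
(* [Z] is the union of the components of the flip that meet [A]. No flipped edge leaves it, so
   adjacency in [G] across the cut only tells whether the two blocks were flipped; at most [k]
   blocks then bound the cut-rank on either side. *)
pose Z : {set G} := [set v : G | [exists a in A, @same_component (flip_graph H) a v]].
have ZA a : a \in A -> a \in Z.
  by move=> Aa; rewrite inE; apply/exists_inP; exists a; rewrite // /same_component connect0.
have ZB b : b \in B -> b \notin Z.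
  by move=> Bb; rewrite inE; apply/exists_inP=> -[a Aa]; apply/negP/sepAB.
pose R t (v : G) := (t, pblock (flip_part H) v) \in flip_pairs H.
have clZ (u v : G) : u \in Z -> v \notin Z -> adj u v = R (pblock (flip_part H) u) v.
  rewrite /R !inE => /exists_inP[a Aa au] Zv.
  have : ~~ flip_adj H u v.
    apply: contra Zv => uv; apply/exists_inP; exists a => //.
    exact: connect_trans au (connect1 uv).
  rewrite /flip_adj negb_and negbK; case/orP=> [/eqP uv|].
    by case/negP: Zv; apply/exists_inP; exists a; rewrite -?uv.
  by case: (adj u v); case: ((_, _) \in flip_pairs H).
have partH x : pblock (flip_part H) x \in flip_part H.
  by rewrite pblock_mem // (cover_partition (flip_partition H)).
exists Z; split.
- by apply: leq_trans cA (subset_leq_card _); apply/subsetP=> a Aa; rewrite inE AW ?ZA.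
- by apply: leq_trans cB (subset_leq_card _); apply/subsetP=> b Bb; rewrite inE BW ?ZB.
- apply: leq_trans (dim_cut_space_classes (R := R) partH clZ) _.
  by rewrite leq_add2l flip_card.
- have clCZ (u v : G) : u \in ~: Z -> v \notin ~: Z ->
      adj u v = R (pblock (flip_part H) u) v.
    rewrite in_setC [v \in _]in_setC negbK => Zu Zv.
    by rewrite adj_sym clZ // /R flip_symmetric.
  apply: leq_trans (dim_cut_space_classes (R := R) partH clCZ) _.
  by rewrite leq_add2l flip_card.
Qed.

Theorem theorem18p4 (C : graph_class) :
  bounded_cliquewidth C <-> infty_flip_breakable C.
Proof.
split; first exact: bounded_cliquewidth_flip_breakable.
exact: flip_breakable_bounded_cliquewidth.
Qed.
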